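(* Let $n\ge1$, $l\in\mathbb{Z}$, and let $\{w_j\}_{j=0}^n$ be a solution of the tt*-Toda equation satisfying the anti-symmetry condition with $l$: $$w_0+w_{l-1}=0,\ w_1+w_{l-2}=0,\ \dots,\qquad w_l+w_n=0,\ w_{l+1}+w_{n-1}=0,\ \dots$$ (that is, $w_j+w_{l-1-j}=0$ for all $j$, with indices modulo $n+1$). Then there exists a solution $\{\tilde w_j\}_{j=0}^n$ of the tt*-Toda equation satisfying, for $j=0,\dots,n$, the anti-symmetry condition $$\begin{cases}\tilde w_j+\tilde w_{n-j}=0 & \text{if } l \text{ or } n \text{ is even},\\ \tilde w_j+\tilde w_{n+1-j}=0 & \text{otherwise},\end{cases}$$ and such that $(w_0,\dots,w_n)\sim_w(\tilde w_0,\dots,\tilde w_n)$.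
   Context: The tt*-Toda equation is the system $(w_j)_{t\bar t}=e^{w_j-w_{j-1}}-e^{w_{j+1}-w_j}$, $w_j:\mathbb{C}^*\to\mathbb{R}$, $t\in\mathbb{C}^*$, with the periodicity $w_j=w_{j+n+1}$ ($j\in\mathbb{Z}$) and an anti-symmetry condition $w_j+w_{l-j-1}=0$ for some $l\in\mathbb{Z}$. The equivalence relation $\sim_w$ on solutions is: $(w^2_0,\dots,w^2_n)\sim_w(w^1_0,\dots,w^1_n)$ iff there exists $s\in\mathbb{Z}$ with $w^2_j=w^1_{j+s}$ for all $j$ (indices modulo $n+1$). *)

(* Defs.v *)
From Stdlib Require Import Reals ZArith Bool.
From Coquelicot Require Import Coquelicot.
Open Scope R_scope.

(* A function on the punctured plane is represented by a total function on C
   whose value at 0 is never used: every clause below is restricted to t <> 0,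
   and, the punctured plane being open, derivatives at t <> 0 do not depend on
   the value at 0. *)

Definition partial_x (f : C -> R) (z : C) : R :=
  Derive (fun x => f (x, Im z)) (Re z).

Definition partial_y (f : C -> R) (z : C) : R :=
  Derive (fun y => f (Re z, y)) (Im z).

Definition C1_punctured (f : C -> R) : Prop :=
  forall z : C, z <> RtoC 0 ->
    ex_derive (fun x => f (x, Im z)) (Re z) /\
    ex_derive (fun y => f (Re z, y)) (Im z) /\
    continuous (partial_x f) z /\
    continuous (partial_y f) z.

Definition C2_punctured (f : C -> R) : Prop :=
  C1_punctured f /\ C1_punctured (partial_x f) /\ C1_punctured (partial_y f).

Definition Cpartial_x (f : C -> C) (z : C) : C :=
  (partial_x (fun u => Re (f u)) z, partial_x (fun u => Im (f u)) z).

Definition Cpartial_y (f : C -> C) (z : C) : C :=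
  (partial_y (fun u => Re (f u)) z, partial_y (fun u => Im (f u)) z).

(* Wirtinger operators: for t = x + i y,
   d/dt = (d/dx - i d/dy) / 2 and d/dtbar = (d/dx + i d/dy) / 2. *)
Definition wirtinger (f : C -> C) (z : C) : C :=
  ((Cpartial_x f z - Ci * Cpartial_y f z) / RtoC 2)%C.

Definition wirtinger_bar (f : C -> C) (z : C) : C :=
  ((Cpartial_x f z + Ci * Cpartial_y f z) / RtoC 2)%C.

Definition toda_system (w : Z -> C -> R) : Prop :=
  forall (j : Z) (t : C), t <> RtoC 0 ->
    wirtinger_bar (wirtinger (fun z => RtoC (w j z))) t =
    RtoC (exp (w j t - w (j - 1)%Z t) - exp (w (j + 1)%Z t - w j t)).

Definition toda_periodic (n : nat) (w : Z -> C -> R) : Prop :=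
  forall (j : Z) (t : C), t <> RtoC 0 ->
    w j t = w (j + Z.of_nat n + 1)%Z t.

Definition toda_antisymmetric (l : Z) (w : Z -> C -> R) : Prop :=
  forall (j : Z) (t : C), t <> RtoC 0 -> w j t + w (l - j - 1)%Z t = 0.

(* The tuple (w_0, ..., w_n), with indices modulo n + 1, is encoded by its
   (n + 1)-periodic extension to Z. Solutions are classical, i.e. of class C^2;
   by elliptic regularity they are then smooth. *)
Definition tt_toda_solution (n : nat) (w : Z -> C -> R) : Prop :=
  (forall j : Z, C2_punctured (w j)) /\
  toda_system w /\
  toda_periodic n w /\
  (exists l : Z, toda_antisymmetric l w).

(* [toda_equiv w2 w1] is w2 ~_w w1. The modulus n + 1 does not appear because
   it is carried by the periodicity of the families. *)
Definition toda_equiv (w2 w1 : Z -> C -> R) : Prop :=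
  exists s : Z, forall (j : Z) (t : C), t <> RtoC 0 ->
    w2 j t = w1 (j + s)%Z t.

(* Main.v *)
(** Shifting the indices by [s] replaces the anti-symmetry index [l] by
    [l - 2 * s], and periodicity allows adding [n + 1] to it, so only [l]
    modulo [gcd 2 (n + 1)] matters: [l] can be moved to [0] when [l] or [n] is
    even, and to [1] otherwise. *)
Require Import Defs.
From Stdlib Require Import Reals ZArith Bool Lia.
From Coquelicot Require Import Coquelicot.
Open Scope R_scope.

Definition shift (s : Z) (w : Z -> C -> R) : Z -> C -> R :=
  fun j => w (j + s)%Z.

(** Anti-symmetry pairs indices with sum [l - 1]; after reindexing, both members of a pair are
    smaller by [s]. *)
Lemma shift_antisymmetric (s l : Z) (w : Z -> C -> R) :
  toda_antisymmetric l w -> toda_antisymmetric (l - 2 * s) (shift s w).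
Proof.
  intros ha j t ht; unfold shift.
  replace (l - 2 * s - j - 1 + s)%Z with (l - (j + s) - 1)%Z by lia.
  now apply ha.
Qed.

Lemma shift_solution (n : nat) (s : Z) (w : Z -> C -> R) :
  tt_toda_solution n w -> tt_toda_solution n (shift s w).
Proof.
  intros (hC & hT & hP & l & ha).
  split; [| split; [| split]].
  - intros j; apply hC.
  - intros j t ht; unfold shift.
    replace (j - 1 + s)%Z with (j + s - 1)%Z by lia.
    replace (j + 1 + s)%Z with (j + s + 1)%Z by lia.
    exact (hT (j + s)%Z t ht).
  - intros j t ht; unfold shift.
    replace (j + Z.of_nat n + 1 + s)%Z with (j + s + Z.of_nat n + 1)%Z by lia.
    now apply hP.
  - exists (l - 2 * s)%Z; now apply shift_antisymmetric.
Qed.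

Lemma shift_equiv (s : Z) (w : Z -> C -> R) : toda_equiv w (shift s w).
Proof.
  exists (- s)%Z; intros j t _; unfold shift; f_equal; lia.
Qed.

(** The partner index of each [j] moves by one full period, which leaves its value unchanged. *)
Lemma antisymmetric_add_period (n : nat) (l : Z) (w : Z -> C -> R) :
  toda_periodic n w -> toda_antisymmetric l w ->
  toda_antisymmetric (l + Z.of_nat n + 1) w.
Proof.
  intros hP ha j t ht.
  replace (l + Z.of_nat n + 1 - j - 1)%Z
    with (l - j - 1 + Z.of_nat n + 1)%Z by lia.
  rewrite <- hP by assumption; now apply ha.
Qed.

Theorem theorem4p1 (n : nat) (l : Z) (w : Z -> C -> R)
    (hn : (1 <= n)%nat)
    (hw : tt_toda_solution n w)
    (hl : toda_antisymmetric l w) :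
  exists wt : Z -> C -> R,
    tt_toda_solution n wt /\
    (forall (j : Z) (t : C), (0 <= j <= Z.of_nat n)%Z -> t <> RtoC 0 ->
       if Z.even l || Nat.even n
       then wt j t + wt (Z.of_nat n - j)%Z t = 0
       else wt j t + wt (Z.of_nat n + 1 - j)%Z t = 0) /\
    toda_equiv w wt.
Proof.
  assert (hP : toda_periodic n w) by apply hw.
  (* [r] is the target anti-symmetry index modulo [n + 1]; a shift by [s] reaches it as soon as [w]
     is anti-symmetric with index [r + 2 * s]. *)
  pose (r := if Z.even l || Nat.even n then 0%Z else 1%Z).
  assert (hs : exists s, toda_antisymmetric (r + 2 * s) w).
  { unfold r; destruct (Z.even l) eqn:el; cbn [orb].
    - apply Z.even_spec in el as [s ->]; now exists s.
    - rewrite <- Z.negb_odd in el; apply negb_false_iff in el.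
      apply Z.odd_spec in el as [s ->].
      destruct (Nat.even n) eqn:en.
      + apply Nat.even_spec in en as [k ->].
        (* With [l = 2 * s + 1] and [n = 2 * k], the period [n + 1] is odd, so adding it makes the
           index even; the witness is half of [l + n + 1]. *)
        exists (s + Z.of_nat k + 1)%Z.
        replace (0 + 2 * (s + Z.of_nat k + 1))%Z
          with (2 * s + 1 + Z.of_nat (2 * k) + 1)%Z by lia.
        exact (antisymmetric_add_period _ _ _ hP hl).
      + exists s; now rewrite Z.add_comm. }
  destruct hs as [s hs].
  exists (shift s w); split; [now apply shift_solution | split].
  - assert (hw' : tt_toda_solution n (shift s w)) by now apply shift_solution.
    (* Index [r] would pair [j] with [r - 1 - j]; adding one period turns this into [r + n - j],
       which is [n - j] or [n + 1 - j] as required. *)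
    assert (ha : toda_antisymmetric (r + Z.of_nat n + 1) (shift s w)).
    { apply antisymmetric_add_period; [apply hw' |].
      replace r with (r + 2 * s - 2 * s)%Z by lia.
      now apply shift_antisymmetric. }
    intros j t _ ht; specialize (ha j t ht); unfold r in ha.
    destruct (Z.even l || Nat.even n).
    + replace (Z.of_nat n - j)%Z with (0 + Z.of_nat n + 1 - j - 1)%Z by lia.
      exact ha.
    + replace (Z.of_nat n + 1 - j)%Z
        with (1 + Z.of_nat n + 1 - j - 1)%Z by lia.
      exact ha.
  - apply shift_equiv.
Qed.
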